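(* Suppose that $\mathcal{L}_S$ (as an operator on $L^1(m)$) is asymptotically periodic, with data $\widehat{s}$, $\widehat{r}(i)$, $\widehat{g}_{i,j}$, $\widehat{\lambda}_{i,j}$ ($1\le i\le \widehat{s}$, $1\le j\le \widehat{r}(i)$), and put $\widehat{g}_i=\frac{1}{\widehat{r}(i)}\sum_{j=1}^{\widehat{r}(i)}\widehat{g}_{i,j}$. Let $Y_0\in\mathcal{B}(Y)$ be a set with $\eta(Y_0)=1$ such that for every $y\in Y_0$ and every $i\in\{1,\dots,\widehat{s}\}$, $$\{\widehat{g}_{i,j}>0\}\subset T_y^{-1}\{\widehat{g}_{i,j+1}>0\}\ (1\le j\le \widehat{r}(i)-1)\quad\text{and}\quad \{\widehat{g}_{i,\widehat{r}(i)}>0\}\subset T_y^{-1}\{\widehat{g}_{i,1}>0\}$$ up to $m$-null sets (such a set exists). Let $Y_1$ be the set of $y\in Y$ such that $\mathcal{L}_{T_y}$ is asymptotically periodic; for $y\in Y_1$ denote the corresponding data by $s(T_y)$, $r(k,T_y)$, $g_{k,j,T_y}$, $\lambda_{k,j,T_y}$, and put $g_{k,T_y}=\frac{1}{r(k,T_y)}\sum_{j=1}^{r(k,T_y)}g_{k,j,T_y}$. Then for every $i\in\{1,\dots,\widehat{s}\}$ and every $y\in Y_0\cap Y_1$ the following hold, where all relations between sets are understood modulo $m$-null sets (so $A\subset B$ means $m(A\setminus B)=0$, $A=\emptyset$ means $m(A)=0$, and $A\neq\emptyset$ means $m(A)>0$). (1) $\{\widehat{g}_i>0\}\cap\bigcup_{k=1}^{s(T_y)}\{g_{k,T_y}>0\}\neq\emptyset$.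 Moreover, for every $k\in\{1,\dots,s(T_y)\}$, either $\{\widehat{g}_i>0\}\supset\{g_{k,T_y}>0\}$ or $\{\widehat{g}_i>0\}\cap\{g_{k,T_y}>0\}=\emptyset$. Consequently $\widehat{s}\le s(T_y)$. (2) For every $k_0\in\{1,\dots,s(T_y)\}$ satisfying $\{\widehat{g}_i>0\}\supset\{g_{k_0,T_y}>0\}$, the integer $\widehat{r}(i)$ is a divisor of $r(k_0,T_y)$.
   Context: Let $(X,\mathcal{F},m)$ be a probability space. A measurable map $T:X\to X$ is $m$-nonsingular if $m(T^{-1}(A))=0$ whenever $A\in\mathcal{F}$, $m(A)=0$. For such $T$ the Perron--Frobenius operator $\mathcal{L}_T$ on $L^1(m)$ is $\mathcal{L}_Tf=\frac{dm_f}{dm}$, where $m_f(A)=\int_{T^{-1}(A)}f\,dm$; equivalently $\int_X(\mathcal{L}_Tf)\,h\,dm=\int_X f\cdot(h\circ T)\,dm$ for all $h\in L^\infty(m)$. Let $Y$ be a complete separable metric space with Borel field $\mathcal{B}(Y)$ and a probability measure $\eta$ on it; let $\Omega=\prod_{i=1}^\infty Y$ with its Borel field $\mathcal{B}(\Omega)$ and the product measure $P=\prod_{i=1}^\infty\eta$. Let $(T_y)_{y\in Y}$ be a family of $m$-nonsingular transformations of $X$ such that $(x,y)\mapsto T_yx$ is measurable. The skew product $S:X\times\Omega\to X\times\Omega$ is $S(x,\omega)=(T_{\omega_1}x,\sigma\omega)$, where $\omega=(\omega_i)_{i\ge1}$ and $\sigma((\omega_i)_{i\ge 1})=(\omega_{i+1})_{i\ge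 1}$. It is nonsingular for $m\times P$ and its Perron--Frobenius operator $\mathcal{L}_S$ on $L^1(m\times P)$ is defined by $\iint h\,\mathcal{L}_Sf\,dm\,dP=\iint f\,(h\circ S)\,dm\,dP$ for $h\in L^\infty(m\times P)$. For $f\in L^1(m)$ (viewed as a function of $(x,\omega)$ not depending on $\omega$), $(\mathcal{L}_Sf)(x,\omega)=\int_Y(\mathcal{L}_{T_y}f)(x)\,\eta(dy)$ a.e., so $\mathcal{L}_S$ maps $L^1(m)$ to itself and is regarded as an operator on $L^1(m)$. Asymptotic periodicity: an operator $\mathcal{L}$ on $L^1(m)$ (here $\mathcal{L}=\mathcal{L}_S$ or $\mathcal{L}=\mathcal{L}_{T_y}$) is asymptotically periodic if there exist positive integers $s$ and $r(i)$ ($1\le i\le s$), probability density functions $g_{i,j}\in L^1(m)$, and bounded linear functionals $\lambda_{i,j}$ on $L^1(m)$ ($1\le i\le s$, $1\le j\le r(i)$) such that: (i) $g_{i,j}\cdot g_{k,l}=0$ for all $(i,j)\ne(k,l)$; (ii) $\mathcal{L}g_{i,j}=g_{i,j+1}$ for $1\le j\le r(i)-1$ and $\mathcal{L}g_{i,r(i)}=g_{i,1}$, for all $i$; (iii) $\lim_{n\to\infty}\big\|\mathcal{L}^n\big(f-\sum_{i=1}^{s}\sum_{j=1}^{r(i)}\lambda_{i,j}(f)g_{i,j}\big)\big\|_{L^1(m)}=0$ for every $f\in L^1(m)$. The data are written $\widehat{s},\widehat{r}(i),\widehat{g}_{i,j},\widehat{\lambda}_{i,j}$ for $\mathcal{L}_S$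 and $s(T_y),r(i,T_y),g_{i,j,T_y},\lambda_{i,j,T_y}$ for $\mathcal{L}_{T_y}$. *)

(* Defs.v *)
From HB Require Import structures.
From mathcomp Require Import all_boot all_order all_algebra.
From mathcomp Require Import all_classical all_reals all_analysis.
Set Implicit Arguments.
Unset Strict Implicit.
Unset Printing Implicit Defensive.
Import Order.TTheory GRing.Theory Num.Theory.
Import numFieldNormedType.Exports.
Local Open Scope classical_set_scope.
Local Open Scope ring_scope.
Local Open Scope charge_scope.

#[short(type="completeMetricType")]
HB.structure Definition CompleteMetric (R : numDomainType) :=
  {T of CompletePseudoMetric R T & Metric R T}.

Definition separable (T : topologicalType) : Prop :=
  exists2 D : set T, countable D & dense D.

Notation borel Y := (g_sigma_algebraType (@open Y)).

(* Y^nat with the product topology; sequences are indexed from 0, so the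
   mathematical omega_1 is [w 0%N]. *)
Notation seqspace Y := {ptws nat -> Y}.

(* The product rule on cylinders determines P: Y being separable, the Borel
   sets of the sequence space are generated by the cylinders. *)
Definition is_product_probability (R : realType) (Y : completeMetricType R)
    (eta : probability (borel Y) R) (P : probability (borel (seqspace Y)) R) :=
  forall (n : nat) (A : nat -> set (borel Y)),
    (forall i, measurable (A i)) ->
    P [set w : seqspace Y | forall i, (i < n)%N -> A i (w i)] =
    (\prod_(i < n) eta (A i))%E.

(* Integrable functions rather than their classes: an equality of L^1(mu) is
   stated below as an equality mu-almost everywhere. *)
Notation L1 mu := (LfunType mu (@lexx _ _ 1%E)).

Definition norm1 d (X : measurableType d) (R : realType)
    (mu : {measure set X -> \bar R}) (f : L1 mu) : \bar R :=
  'N[mu]_1[EFin \o f]%E.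

Definition nonsingular d (X : measurableType d) (R : realType)
    (mu : {measure set X -> \bar R}) (T : X -> X) : Prop :=
  forall A, measurable A -> mu A = 0%E -> mu (T @^-1` A) = 0%E.

Section PerronFrobenius.
Context d (X : measurableType d) (R : realType) (m : probability X R).

Lemma L1_integrable (f : L1 m) : m.-integrable [set: X] (EFin \o f).
Proof. by apply/Lfun1_integrable; exact: LfunP. Qed.

Definition transported_charge (T : {mfun X >-> X}) (f : L1 m) (A : set X) :
  \bar R := (\int[m]_(x in T @^-1` A) (f x)%:E)%E.

Section charge_instance.
Variables (T : {mfun X >-> X}) (f : L1 m).

Let nu : {charge set X -> \bar R} :=
  measure_function_pushforward__canonical__charge_Charge
    (induced_charge (L1_integrable f)) (measurable_funPT T).

Let nu0 : transported_charge T f set0 = 0%E. Proof. exact: (charge0 nu). Qed.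

Let nu_finite A : measurable A -> transported_charge T f A \is a fin_num.
Proof. exact: (@fin_num_measure _ _ _ nu). Qed.

Let nu_sigma_additive : semi_sigma_additive (transported_charge T f).
Proof. exact: (@charge_semi_sigma_additive _ _ _ nu). Qed.

HB.instance Definition _ := isCharge.Build _ _ _ (transported_charge T f)
  nu0 nu_finite nu_sigma_additive.

End charge_instance.

(* For nonsingular T the Radon--Nikodym derivative is finite and integrable, and
   the default value 0 of insubd is not used. *)
Definition PF (T : {mfun X >-> X}) (f : L1 m) : L1 m :=
  insubd (0 : L1 m) (fine \o ('d (transported_charge T f) '/d m)).

End PerronFrobenius.

Definition skew_product (X Y : Type) (T : Y -> X -> X) (z : X * (nat -> Y)) :
    X * (nat -> Y) :=
  (T (z.2 0%N) z.1, fun n => z.2 n.+1).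

(* [LS] is the operator on L^1(m) obtained by restricting to functions of x
   alone the Perron--Frobenius operator of the skew product on L^1(m \x P):
   (x, w) |-> LS f x is the image of (x, w) |-> f x. *)
Definition is_skew_PF d (X : measurableType d) (R : realType)
    (Y : completeMetricType R) (m : probability X R)
    (P : probability (borel (seqspace Y)) R) (T : Y -> {mfun X >-> X})
    (LS : L1 m -> L1 m) : Prop :=
  forall (f : L1 m) (h : X * borel (seqspace Y) -> R),
    h \in Lfun (m \x P)%E +oo%E ->
    (\int[m \x P]_z (h z * LS f z.1)%:E =
     \int[m \x P]_z (f z.1 * h (skew_product T z))%:E)%E.

Record periodic_data d (X : measurableType d) (R : realType)
    (m : probability X R) := PeriodicData {
  pd_s : nat ;
  pd_r : 'I_pd_s -> nat ;
  pd_g : forall i, 'I_(pd_r i) -> L1 m ;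
  pd_lambda : forall i, 'I_(pd_r i) -> {scalar L1 m} }.
Arguments pd_r {d X R m} _ _.

Section AsymptoticPeriodicity.
Context d (X : measurableType d) (R : realType) (m : probability X R).

Definition is_density (g : L1 m) : Prop :=
  {ae m, forall x, 0 <= g x} /\ (\int[m]_x (g x)%:E = 1)%E.

Definition bounded_functional (l : {scalar L1 m}) : Prop :=
  exists C : R, forall f : L1 m, (`|l f|%:E <= C%:E * norm1 f)%E.

(* [ordS j] is the cyclic successor of j in 'I_(pd_r D i). *)
Definition has_periodic_data (L : L1 m -> L1 m) (D : periodic_data m) : Prop :=
  [/\ (0 < pd_s D)%N /\ (forall i, (0 < pd_r D i)%N),
      (forall i (j : 'I_(pd_r D i)), is_density (pd_g j)) /\
      (forall i (j : 'I_(pd_r D i)), bounded_functional (pd_lambda j)),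
      forall i (j : 'I_(pd_r D i)) k (l : 'I_(pd_r D k)),
        (i : nat, j : nat) <> (k : nat, l : nat) ->
        {ae m, forall x, pd_g j x * pd_g l x = 0},
      forall i (j : 'I_(pd_r D i)),
        {ae m, forall x, L (pd_g j) x = pd_g (ordS j) x} &
      forall f : L1 m,
        norm1 (iter n L
          (f - \sum_(i < pd_s D) \sum_(j < pd_r D i) pd_lambda j f *: pd_g j))
        @[n --> \oo] --> 0%E].

Definition asymptotically_periodic (L : L1 m -> L1 m) : Prop :=
  exists D : periodic_data m, has_periodic_data L D.

Definition mean_density (D : periodic_data m) (i : 'I_(pd_s D)) : L1 m :=
  (pd_r D i)%:R^-1 *: \sum_(j < pd_r D i) pd_g j.

Definition pos_support (g : X -> R) : set X := [set x | 0 < g x].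

Definition ae_subset (A B : set X) : Prop := m (A `\` B) = 0%E.

(* ordS closes the cycle: the last support is sent into the first one. *)
Definition transports_supports (Y : completeMetricType R)
    (eta : probability (borel Y) R) (T : Y -> {mfun X >-> X})
    (D : periodic_data m) (Y0 : set (borel Y)) : Prop :=
  [/\ measurable Y0, eta Y0 = 1%E &
      forall y, Y0 y -> forall i (j : 'I_(pd_r D i)),
        ae_subset (pos_support (pd_g j))
                  (T y @^-1` pos_support (pd_g (ordS j)))].

End AsymptoticPeriodicity.

(* Main.v *)
(* Integrals against densities replace L^1 identities: the integral over A of
   L^n f is the integral of f over T^{-n} A, so asymptotic periodicity of
   L = L_{T_y} says that the integral of f over T^{-n} A_n is asymptotic to the
   sum of the lambda_{k,l}(f) int_{A_n} g_{k,l+n}, for any sequence A_n.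

   Let C_n be sets with C_n contained in T^{-1} C_{n+1}, and suppose that
   c_n = int_{C_n} g_{k,l+n}, which is nondecreasing, has c_0 > 0.  Apply the
   above to f = g_{k,l} 1_{C_0}.  With A_n = {g_{k,l+n} > 0} it gives
   lambda_{k,l}(f) = c_0; with A_n = C_n /\ {g_{k,l+n} > 0} it then gives
   c_0 (1 - c_n) --> 0.  Hence c_n --> 1, and c_0 = 1 if C_n is periodic.

   The constant chain C_n = {ghat_i > 0} yields the dichotomy of (1).  The chain
   C_n = {ghat_{i,j+n} > 0} yields (2): if it meets {g_{k,l} > 0} at time 0,
   it contains it both at time 0 and at time r(k), so j + r(k) = j modulo
   rhat(i), as the sets C_n with n < rhat(i) are disjoint.

   Y_0 exists by testing the definition of L_S on the indicator of the
   complement of {ghat_{i,j+1} > 0}, and by Fubini. *)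
Require Import Defs.
From HB Require Import structures.
From mathcomp Require Import all_boot all_order all_algebra.
From mathcomp Require Import all_classical all_reals all_analysis.
From mathcomp Require Import measurable_realfun.
Import Order.TTheory GRing.Theory Num.Theory.
Import numFieldNormedType.Exports.
Local Open Scope classical_set_scope.
Local Open Scope ring_scope.

Set Implicit Arguments.
Unset Strict Implicit.
Unset Printing Implicit Defensive.

(** * Iterates of the cyclic successor *)

Lemma val_iter_ordS n p (j : 'I_p) :
  val (iter n (@ordS p) j) = ((j + n) %% p)%N.
Proof.
elim: n => [|n IHn]; first by rewrite addn0 modn_small.
by rewrite iterS /= IHn -addn1 modnDml addn1 addnS.
Qed.

Lemma iter_ordS_mod n p (j : 'I_p) : (p %| n)%N -> iter n (@ordS p) j = j.
Proof.
move=> /dvdnP[q ->]; apply: val_inj.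
by rewrite val_iter_ordS addnC modnMDl modn_small.
Qed.

Lemma iter_ordS_inj n p : injective (iter n (@ordS p)).
Proof.
elim: n => // n IHn x y /=.
by move=> /(can_inj (@ordSK p)) /IHn.
Qed.

Lemma iter_ordS_trans p (j k : 'I_p) : exists n, iter n (@ordS p) j = k.
Proof.
(* This number is congruent to [k - j] modulo [p]; adding [p - j] avoids truncated subtraction. *)
exists (k + (p - j))%N; apply: val_inj; rewrite val_iter_ordS.
by rewrite addnCA subnKC ?modnDr ?modn_small// ltnW.
Qed.

(** * Integrals of integrable functions over sets, as real numbers *)

Section Mass.
Context d (X : measurableType d) (R : realType) (m : probability X R).
Implicit Types (f g : L1 m) (A B : set X).

Definition mass A f : R := \int[m]_(x in A) f x.

Lemma measurable_pos_support f : measurable (pos_support f).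
Proof.
have mf : measurable_fun [set: X] f by [].
rewrite (_ : pos_support f = [set: X] `&` f @^-1` `]0, +oo[%classic).
  by apply: mf.
by rewrite setTI; apply/seteqP; split=> x /=; rewrite /pos_support /=
  in_itv /= andbT.
Qed.

Lemma L1_integrableS A f : measurable A -> m.-integrable A (EFin \o f).
Proof.
by move=> mA; apply: (integrableS measurableT) => //; exact: L1_integrable.
Qed.

Lemma EFin_mass A f :
  measurable A -> (mass A f)%:E = (\int[m]_(x in A) (f x)%:E)%E.
Proof.
move=> mA; rewrite fineK//; apply: integrable_fin_num => //.
exact: L1_integrableS.
Qed.

Lemma mass_scalar A : measurable A -> scalar (mass A).
Proof.
move=> mA a f g; rewrite /mass -RintegralZl//; last exact: (L1_integrableS f mA).
rewrite -RintegralD//; last exact: (L1_integrableS g mA).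
exact: (L1_integrableS (a *: f) mA).
Qed.

Lemma ae_mass_le A B f g : measurable A -> measurable B ->
  {ae m, forall x, (f \_ A) x <= (g \_ B) x} -> mass A f <= mass B g.
Proof.
move=> mA mB fg.
rewrite /mass Rintegral_mkcond [leRHS]Rintegral_mkcond -subr_ge0.
have intr h C : measurable C -> m.-integrable setT (EFin \o ((h : L1 m) \_ C)).
  move=> mC; rewrite -restrict_EFin; apply/(integrable_mkcond _ mC).
  exact: L1_integrableS.
have intB : m.-integrable setT (EFin \o (fun x => (g \_ B) x - (f \_ A) x)).
  rewrite (_ : _ \o _ = (EFin \o (g \_ B)) \- (EFin \o (f \_ A)))%E//.
  by apply: integrableB => //; exact: intr.
rewrite -RintegralB//; [|exact: intr..].
(* The difference is nonnegative only almost everywhere. Its absolute value has the same integral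
   and is nonnegative at every point, as [integral_ge0] requires. *)
rewrite /Rintegral (ae_eq_integral (fun x => `|(g \_ B) x - (f \_ A) x|%:E))//.
- by rewrite fine_ge0// integral_ge0.
- exact: (measurable_int m).
- by have := measurableT_comp (@abse_measurable R setT) (measurable_int m intB).
- rewrite /ae_eq; apply: filterS fg => x fgx _.
  by rewrite ger0_norm// subr_ge0.
Qed.

Lemma ae_mass_eq A B f g : measurable A -> measurable B ->
  {ae m, forall x, (f \_ A) x = (g \_ B) x} -> mass A f = mass B g.
Proof.
move=> mA mB fg; apply/eqP; rewrite eq_le; apply/andP; split.
  by apply: ae_mass_le => //; apply: filterS fg => x ->.
by apply: ae_mass_le => //; apply: filterS fg => x ->.
Qed.

Lemma mass_eq0 A f : measurable A -> {ae m, forall x, A x -> f x = 0} ->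
  mass A f = 0.
Proof.
move=> mA fA; rewrite (@ae_mass_eq A set0 f f)//.
  by rewrite /mass Rintegral_set0.
apply: filterS fA => x fx; rewrite !patchE in_set0; case: ifPn => //.
by move/set_mem/fx.
Qed.

Lemma mass_eq0_ae A f : measurable A -> {ae m, forall x, 0 <= f x} ->
  mass A f = 0 -> {ae m, forall x, A x -> f x = 0}.
Proof.
move=> mA f0 fA.
have mf : measurable_fun A (EFin \o f).
  by apply: (measurable_int m); exact: L1_integrableS.
have : (\int[m]_(x in A) `|(f x)%:E|)%E = 0%E.
  rewrite -[RHS]/(0%:E) -fA EFin_mass//; apply: ae_eq_integral => //.
    exact: measurableT_comp.
  by apply: filterS f0 => x ? _; rewrite gee0_abs// lee_fin.
move/(ae_eq_integral_abs _ mA mf); apply: filterS => x fx Ax.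
by have [] := fx Ax.
Qed.

Lemma mass_ge0 A f :
  measurable A -> {ae m, forall x, 0 <= f x} -> 0 <= mass A f.
Proof.
move=> mA f0; rewrite [0](_ : _ = mass set0 f); last first.
  by rewrite /mass Rintegral_set0.
apply: ae_mass_le => //; apply: filterS f0 => x fx.
by rewrite patch_set0 patchE; case: ifPn.
Qed.

(** Where [f] vanishes both restrictions are zero, so it suffices to compare them where [f] is
    positive. *)
Lemma ae_mass_subset A B f : measurable A -> measurable B ->
  {ae m, forall x, 0 <= f x} -> {ae m, forall x, 0 < f x -> A x -> B x} ->
  mass A f <= mass B f.
Proof.
move=> mA mB f0 AB; apply: ae_mass_le => //; apply: filterS2 f0 AB => x f0 AB.
rewrite !patchE; case: ifPn => [/set_mem Ax|_]; last by case: ifP.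
move: f0; rewrite le_eqVlt => /predU1P[<-|/AB/(_ Ax) Bx]; first by case: ifP.
by rewrite mem_set.
Qed.

(** By additivity the complement of [A] has mass zero, and a nonnegative function vanishes almost
    everywhere on a set over which its integral is zero. *)
Lemma mass_setT_ae A f : measurable A -> {ae m, forall x, 0 <= f x} ->
  mass A f = mass setT f -> {ae m, forall x, 0 < f x -> A x}.
Proof.
move=> mA f0 fA.
have : mass (~` A) f = 0.
  have : mass setT f = mass A f + mass (~` A) f.
    rewrite -(setUv A) /mass Rintegral_setU//.
    - exact: measurableC.
    - rewrite setUv; exact: L1_integrable.
    - by apply/disj_setPS => x [].
  by rewrite fA => /eqP; rewrite addrC -subr_eq subrr => /eqP <-.
move/(mass_eq0_ae (measurableC mA) f0); apply: filterS => x fx fx0.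
by apply: contrapT => /fx fx0'; move: fx0; rewrite fx0' ltxx.
Qed.

Lemma ae_subsetP A B : measurable A -> measurable B ->
  ae_subset m A B <-> {ae m, forall x, A x -> B x}.
Proof.
move=> mA mB; rewrite /ae_subset; split=> [AB|].
  exists (A `\` B); split=> //; first exact: measurableD.
  by move=> x /= /not_implyP.
move=> /negligibleP; rewrite (_ : ~` _ = A `\` B); last first.
  by apply/seteqP; split=> x /=; rewrite not_implyE.
by apply; exact: measurableD.
Qed.

End Mass.

(** * Nonsingular maps and the duality between [PF] and preimages *)

Section NonsingularMaps.
Local Open Scope charge_scope.
Context d (X : measurableType d) (R : realType) (m : probability X R).
Variable T : {mfun X >-> X}.
Hypothesis Tns : nonsingular m T.
Implicit Types (f g : L1 m) (A B : set X).

Lemma measurable_preimage A : measurable A -> measurable (T @^-1` A).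
Proof. by move=> mA; rewrite -[X in measurable X]setTI; apply: measurable_funPT. Qed.

Lemma measurable_preimage_iter n A :
  measurable A -> measurable (iter n T @^-1` A).
Proof.
elim: n A => // n IHn A mA.
by apply: (IHn (T @^-1` A)); exact: measurable_preimage.
Qed.

(** Nonsingularity makes the preimage of the exceptional null set null. *)
Lemma ae_preimage (P : X -> Prop) :
  {ae m, forall x, P x} -> {ae m, forall x, P (T x)}.
Proof.
case=> N [mN N0 subN]; exists (T @^-1` N); split; first exact: measurable_preimage.
  exact: Tns.
by move=> x /= nPx; exact: subN.
Qed.

Lemma ae_preimage_iter n (P : X -> Prop) :
  {ae m, forall x, P x} -> {ae m, forall x, P (iter n T x)}.
Proof. by elim: n P => // n IHn P /ae_preimage/IHn. Qed.

(** Duality tested on indicators. By nonsingularity the transported charge is absolutely continuous,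
    so it is recovered by integrating its Radon-Nikodym derivative. *)
Lemma mass_PF A f : measurable A -> mass A (PF T f) = mass (T @^-1` A) f.
Proof.
move=> mA.
have dom : transported_charge T f `<< m.
  apply/null_content_dominatesP => B mB B0.
  have mTB := measurable_preimage mB.
  apply: null_set_integral => //.
    exact: (measurable_int m (L1_integrableS f mTB)).
  exact: Tns.
have RNE x : (fine (('d (transported_charge T f) '/d m) x))%:E =
    ('d (transported_charge T f) '/d m) x.
  by rewrite fineK// Radon_Nikodym_fin_num.
(* The derivative is integrable, so [insubd] returns it and not the default 0. *)
have PFE : PF T f = fine \o ('d (transported_charge T f) '/d m) :> (X -> R).
  apply: insubdK; apply/Lfun1_integrable.
  rewrite (_ : _ \o _ = 'd (transported_charge T f) '/d m).
    exact: Radon_Nikodym_integrable.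
  exact/funext.
apply: EFin_inj; rewrite !EFin_mass//; last exact: measurable_preimage.
rewrite -[RHS]/(transported_charge T f A) (Radon_Nikodym_integral dom mA).
by apply: eq_integral => x _; rewrite PFE /= RNE.
Qed.

Lemma mass_iter_PF n A f :
  measurable A -> mass A (iter n (PF T) f) = mass (iter n T @^-1` A) f.
Proof.
elim: n A => // n IHn A mA.
by rewrite iterS mass_PF// IHn//; exact: measurable_preimage.
Qed.

End NonsingularMaps.

(** * Elementary properties of periodic data *)

Section Periodic.
Context d (X : measurableType d) (R : realType) (m : probability X R).
Variables (L : L1 m -> L1 m) (D : periodic_data m).
Hypothesis HD : has_periodic_data L D.
Implicit Types (i k : 'I_(pd_s D)).

Lemma pd_r_gt0 i : (0 < pd_r D i)%N.
Proof. by case: HD => -[]. Qed.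

Lemma pd_g_ge0 i (j : 'I_(pd_r D i)) : {ae m, forall x, 0 <= pd_g j x}.
Proof. by case: HD => _ [+ _] _ _ _ => /(_ i j)[]. Qed.

Lemma mass_pd_g i (j : 'I_(pd_r D i)) : mass setT (pd_g j) = 1.
Proof.
by case: HD => _ [+ _] _ _ _ => /(_ i j)[_]; rewrite /mass /Rintegral => ->.
Qed.

Lemma pd_g_disjoint i (j : 'I_(pd_r D i)) k (l : 'I_(pd_r D k)) :
    (i : nat, j : nat) <> (k : nat, l : nat) ->
  {ae m, forall x, ~ (0 < pd_g j x /\ 0 < pd_g l x)}.
Proof.
case: HD => _ _ + _ _ => /[apply]; apply: filterS => x jl [j0 l0].
by have := mulr_gt0 j0 l0; rewrite jl ltxx.
Qed.

Lemma ae_pos_mean_density i :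
  {ae m, forall x,
    0 < mean_density i x <-> exists j : 'I_(pd_r D i), 0 < pd_g j x}.
Proof.
have : {ae m, forall x, forall j : 'I_(pd_r D i), 0 <= pd_g j x}.
  by apply: filter_forall => j; exact: pd_g_ge0.
apply: filterS => x g0.
have -> : mean_density i x = (pd_r D i)%:R^-1 * \sum_(j < pd_r D i) pd_g j x.
  rewrite /mean_density /=; congr (_ * _).
  by elim/big_ind2 : _ => // ? ? ? ? <- <-.
rewrite pmulr_rgt0 ?invr_gt0 ?ltr0n ?pd_r_gt0//; split=> [|[j gj]].
  rewrite lt0r psumr_neq0// => /andP[/hasP[j _ gj] _].
  by exists j.
by rewrite (bigD1 j)//= ltr_pwDl// sumr_ge0.
Qed.

End Periodic.

(** * Restriction and norm bounds for integrable functions *)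

Section RestrictL1.
Context d (X : measurableType d) (R : realType) (m : probability X R).
Implicit Types (f g : L1 m) (A B : set X).

(** The functionals [pd_lambda] and the convergence in [has_periodic_data] take arguments of type
    [L1 m], so a restricted density must be realized in that type. *)
Lemma L1_restrict C f : measurable C -> exists g : L1 m, g = f \_ C :> (X -> R).
Proof.
move=> mC.
have fC : f \_ C \in Lfun m 1.
  apply/Lfun1_integrable; rewrite -restrict_EFin.
  by apply/(integrable_mkcond _ mC); exact: L1_integrableS.
by exists (Lfun_Sub (@lexx _ _ 1%E) fC).
Qed.

Lemma le_norm1_mass A f : measurable A -> `|mass A f| <= fine (norm1 f).
Proof.
move=> mA; rewrite (le_trans (le_normr_Rintegral _ (L1_integrableS f mA)))//.
have intn : m.-integrable setT (fun x => `|f x|%:E).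
  by have := integrable_norm (L1_integrable f).
rewrite /norm1 Lnorm1 -[leRHS]/(Rintegral m setT (fun x => `|f x|)).
rewrite Rintegral_mkcond; apply: le_Rintegral => //.
  rewrite -restrict_EFin; apply/(integrable_mkcond _ mA).
  exact: integrableS intn.
by move=> x _; rewrite patchE; case: ifP => _ //; exact: normr_ge0.
Qed.

End RestrictL1.

(** * Masses of the densities along chains of sets *)

Section Chains.
Context d (X : measurableType d) (R : realType) (m : probability X R).
Variable T : {mfun X >-> X}.
Hypothesis Tns : nonsingular m T.
Variable D : periodic_data m.
Hypothesis HD : has_periodic_data (PF T) D.
Implicit Types (f g : L1 m) (A B : set X) (i k : 'I_(pd_s D)).

Lemma mass_preimage_pd_g A i (j : 'I_(pd_r D i)) : measurable A ->
  mass (T @^-1` A) (pd_g j) = mass A (pd_g (ordS j)).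
Proof.
move=> mA; rewrite -mass_PF//; apply: ae_mass_eq => //.
case: HD => _ _ _ /(_ i j) + _; apply: filterS => x gx.
by rewrite !patchE gx.
Qed.

Lemma mass_preimage_iter_pd_g n A i (j : 'I_(pd_r D i)) : measurable A ->
  mass (iter n T @^-1` A) (pd_g j) = mass A (pd_g (iter n (@ordS _) j)).
Proof.
elim: n A => // n IHn A mA.
rewrite iterS -mass_preimage_pd_g//; apply: (IHn (T @^-1` A)).
exact: measurable_preimage.
Qed.

(** By duality the difference is the integral over [A n] of the [n]-th iterate at [f] minus its
    periodic part. The L1 norm bounds it uniformly in the set, which is why [A] may vary with
    [n]. *)
Lemma asymptotic_mass f (A : nat -> set X) : (forall n, measurable (A n)) ->
  mass (iter n T @^-1` A n) f -
    \sum_(i < pd_s D) \sum_(j < pd_r D i)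
      pd_lambda j f * mass (A n) (pd_g (iter n (@ordS _) j))
  @[n --> \oo] --> 0.
Proof.
move=> mA; set h : L1 m :=
  f - \sum_(i < pd_s D) \sum_(j < pd_r D i) pd_lambda j f *: pd_g j.
have mTA n : measurable (iter n T @^-1` A n) by exact: measurable_preimage_iter.
rewrite [X in X @ \oo](_ : _ = fun n => mass (A n) (iter n (PF T) h)); last first.
  apply/funext => n; rewrite mass_iter_PF//.
  (* Packing the integral as a linear form lets it pass through the double sum. *)
  pose J : {scalar L1 m} := HB.pack (mass (iter n T @^-1` A n))
    (GRing.isLinear.Build _ _ _ _ (mass (iter n T @^-1` A n)) (mass_scalar (mTA n))).
  rewrite -[RHS]/(J h) /h linearB [in RHS]linear_sum; congr (_ - _).
  apply: eq_bigr => i _; rewrite (linear_sum J); apply: eq_bigr => j _.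
  by rewrite linearZ /= mass_preimage_iter_pd_g.
have h0 : fine (norm1 (iter n (PF T) h)) @[n --> \oo] --> 0.
  by apply: fine_cvg; case: HD => _ _ _ _; exact.
apply: norm_cvg0; apply: (squeeze_cvgr _ (cvg_cst 0) h0).
by apply: nearW => n /=; rewrite normr_ge0 le_norm1_mass.
Qed.

(** Induction along orbits: the null set on which the [n]-th inclusion fails is pulled back by
    [iter n T] and remains null. *)
Lemma ae_subset_chain (C : nat -> set X) : (forall n, measurable (C n)) ->
  (forall n, ae_subset m (C n) (T @^-1` C n.+1)) ->
  forall n, {ae m, forall x, C 0%N x -> C n (iter n T x)}.
Proof.
move=> mC subC; elim=> [|n IHn]; first exact: nearW.
have /ae_subsetP -/(_ (mC n) (measurable_preimage T (mC n.+1))) := subC n.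
move/(ae_preimage_iter Tns n); apply: filterS2 IHn => x IHx Cx C0.
by apply: Cx; exact: IHx.
Qed.

Lemma mass_chain_le (C : nat -> set X) i (j : 'I_(pd_r D i)) :
  (forall n, measurable (C n)) ->
  (forall n, ae_subset m (C n) (T @^-1` C n.+1)) ->
  forall n, mass (C 0%N) (pd_g j) <= mass (C n) (pd_g (iter n (@ordS _) j)).
Proof.
move=> mC subC n; rewrite -mass_preimage_iter_pd_g//.
apply: ae_mass_subset => //; first exact: measurable_preimage_iter.
  exact: (pd_g_ge0 HD).
by have := ae_subset_chain mC subC n; apply: filterS => x Cx _.
Qed.

Lemma mass_sub_pos_support A i (j : 'I_(pd_r D i)) k (l : 'I_(pd_r D k)) :
    measurable A -> A `<=` pos_support (pd_g j) ->
    (k : nat, l : nat) <> (i : nat, j : nat) ->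
  mass A (pd_g l) = 0.
Proof.
move=> mA subA kl; apply: mass_eq0 => //.
have := pd_g_ge0 HD l; have := pd_g_disjoint HD kl.
apply: filterS2 => x disj gl Ax; apply/eqP; rewrite eq_le gl andbT leNgt.
by apply/negP => gl0; apply: disj; split=> //; exact: subA.
Qed.

(** Shifting by [n] is injective on each cycle, so the shifted densities other than that of [(i, j)]
    still have supports disjoint from [A] up to a null set. *)
Lemma sum_mass_sub_pos_support (c : forall k, 'I_(pd_r D k) -> R) n A i
    (j : 'I_(pd_r D i)) :
    measurable A -> A `<=` pos_support (pd_g (iter n (@ordS _) j)) ->
  \sum_(k < pd_s D) \sum_(l < pd_r D k)
    c k l * mass A (pd_g (iter n (@ordS _) l)) =
  c i j * mass A (pd_g (iter n (@ordS _) j)).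
Proof.
move=> mA subA; rewrite (bigD1 i)//= [X in _ + X]big1 ?addr0; last first.
  move=> k ki; rewrite big1// => l _.
  rewrite (mass_sub_pos_support mA subA) ?mulr0//.
  by case=> /val_inj /eqP; rewrite (negbTE ki).
rewrite (bigD1 j)//= big1 ?addr0// => l lj.
rewrite (mass_sub_pos_support mA subA) ?mulr0//.
by case=> /val_inj /iter_ordS_inj /eqP; rewrite (negbTE lj).
Qed.

Lemma mass_chain_cvg (C : nat -> set X) i (j : 'I_(pd_r D i)) :
  (forall n, measurable (C n)) ->
  (forall n, ae_subset m (C n) (T @^-1` C n.+1)) ->
  0 < mass (C 0%N) (pd_g j) ->
  mass (C n) (pd_g (iter n (@ordS _) j)) @[n --> \oo] --> (1 : R).
Proof.
move=> mC subC c0_gt0; set c0 := mass _ _ in c0_gt0.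
pose B n := pos_support (pd_g (iter n (@ordS _) j)).
have mB n : measurable (B n) by exact: measurable_pos_support.
have gB n : mass (B n) (pd_g (iter n (@ordS _) j)) = 1.
  rewrite -(mass_pd_g HD (iter n (@ordS _) j)); apply: ae_mass_eq => //.
  have := pd_g_ge0 HD (iter n (@ordS _) j); apply: filterS => x.
  rewrite patch_setT patchE le_eqVlt => /predU1P[<-|g0]; first by case: ifP.
  by rewrite mem_set.
(* The preimage of [B n] under [iter n T] carries the full mass of [pd_g j]. *)
have aeB n : {ae m, forall x, 0 < pd_g j x -> B n (iter n T x)}.
  apply: (@mass_setT_ae _ _ _ _ (iter n T @^-1` B n)).
  - exact: measurable_preimage_iter.
  - exact: (pd_g_ge0 HD).
  - by rewrite mass_preimage_iter_pd_g// gB (mass_pd_g HD).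
have [f fE] := L1_restrict (pd_g j) (mC 0%N).
(* Almost every point where [f] is positive is sent by [iter n T] into both [C n] and [B n], so the
   preimage of [A] carries all of [f]. *)
have massf n A : measurable A -> C n `&` B n `<=` A ->
    mass (iter n T @^-1` A) f = c0.
  move=> mA CBA; apply: ae_mass_eq => //; first exact: measurable_preimage_iter.
  have := pd_g_ge0 HD j.
  apply: filterS3 (ae_subset_chain mC subC n) (aeB n) => x Cx Bx.
  rewrite fE !patchE; case: (boolP (x \in C 0%N)); last by case: ifP.
  move/set_mem => C0.
  rewrite le_eqVlt => /predU1P[<-|g0]; first by case: ifP.
  by rewrite mem_set//=; apply: CBA; split; [exact: Cx|exact: Bx].
(* The inclusion of [A n] in [B n] leaves a single term of the double sum. *)
have lam (A : nat -> set X) : (forall n, measurable (A n)) ->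
    (forall n, C n `&` B n `<=` A n) -> (forall n, A n `<=` B n) ->
    c0 - pd_lambda j f * mass (A n) (pd_g (iter n (@ordS _) j))
      @[n --> \oo] --> 0.
  move=> mA CBA AB.
  rewrite [X in X @ \oo](_ : _ = fun n => mass (iter n T @^-1` A n) f -
    \sum_(k < pd_s D) \sum_(l < pd_r D k)
      pd_lambda l f * mass (A n) (pd_g (iter n (@ordS _) l))).
    exact: asymptotic_mass.
  apply/funext => n.
  by rewrite massf// (sum_mass_sub_pos_support (fun k l => pd_lambda l f) _ (AB n)).
(* With [A = B] the sequence is constant, so its limit determines the coefficient. *)
have lamE : pd_lambda j f = c0.
  have := lam B mB (fun n => @subIsetr _ _ _) (fun n => @subset_refl _ _).
  under eq_fun do rewrite gB mulr1.
  move/(cvg_unique (@norm_hausdorff _ _) (cvg_cst _))/eqP.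
  by rewrite subr_eq0 => /eqP.
have := lam (fun n => C n `&` B n) (fun n => measurableI _ _ (mC n) (mB n))
  (fun n => @subset_refl _ _) (fun n => @subIsetr _ _ _).
rewrite lamE => CB0.
(* Division by [c0], which is positive; intersecting with [B n] does not change the mass of a
   density supported there. *)
rewrite [X in X @ \oo](_ : _ = fun n =>
    1 - c0^-1 * (c0 - c0 * mass (C n `&` B n) (pd_g (iter n (@ordS _) j)))).
  rewrite -[X in _ --> X]subr0 -[X in _ --> _ - X](mulr0 c0^-1).
  by apply: cvgB; [exact: cvg_cst|apply: cvgM => //; exact: cvg_cst].
apply/funext => n; rewrite mulrBr mulVf ?gt_eqF// mulKf ?gt_eqF//.
rewrite opprB addrC subrK; apply: ae_mass_eq => //; first exact: measurableI.
have := pd_g_ge0 HD (iter n (@ordS _) j); apply: filterS => x.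
rewrite !patchE in_setI le_eqVlt => /predU1P[<-|g0]; last first.
  by rewrite (mem_set (g0 : B n x)) andbT.
by case: (x \in C n); case: (x \in _).
Qed.

(** At multiples of [p * pd_r D i] both the set and the density return to their initial values, so
    the sequence of [mass_chain_cvg] has a constant subsequence. *)
Lemma mass_periodic_chain (C : nat -> set X) p i (j : 'I_(pd_r D i)) :
  (forall n, measurable (C n)) ->
  (forall n, ae_subset m (C n) (T @^-1` C n.+1)) ->
  (0 < p)%N -> (forall n, (p %| n)%N -> C n = C 0%N) ->
  0 < mass (C 0%N) (pd_g j) -> mass (C 0%N) (pd_g j) = 1.
Proof.
move=> mC subC p0 Cp /(mass_chain_cvg mC subC) C1.
have N0 : (0 < p * pd_r D i)%N by rewrite muln_gt0 p0 (pd_r_gt0 HD).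
have := cvg_comp _ _ (cvg_mulnr _ N0) C1.
rewrite [X in X @ \oo](_ : _ = fun=> mass (C 0%N) (pd_g j)).
  by move/(cvg_unique (@norm_hausdorff _ _) (cvg_cst _)).
apply/funext => n /=; rewrite Cp; last by rewrite mulnCA dvdn_mulr.
by rewrite iter_ordS_mod// mulnA dvdn_mull.
Qed.

End Chains.

(** * Supports of the densities and of their cycle means *)

Section Supports.
Context d (X : measurableType d) (R : realType) (m : probability X R).
Implicit Types (A : set X).

Lemma measure_eq0_ae A : measurable A ->
  m A = 0%E <-> {ae m, forall x, ~ A x}.
Proof.
move=> mA; have := ae_subsetP m mA measurable0.
by rewrite /ae_subset setD0 => ->; split; apply: filterS.
Qed.

Variables (L : L1 m -> L1 m) (D : periodic_data m).
Hypothesis HD : has_periodic_data L D.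

Lemma mass_eq0_not_pos A i (j : 'I_(pd_r D i)) : measurable A ->
  mass A (pd_g j) = 0 -> {ae m, forall x, A x -> ~ 0 < pd_g j x}.
Proof.
move=> mA /(mass_eq0_ae mA (pd_g_ge0 HD j)); apply: filterS => x gx Ax.
by rewrite gx// ltxx.
Qed.

Lemma mass_le1 A i (j : 'I_(pd_r D i)) : measurable A -> mass A (pd_g j) <= 1.
Proof.
move=> mA; rewrite -[leRHS](mass_pd_g HD j); apply: ae_mass_subset => //.
  exact: (pd_g_ge0 HD).
exact: nearW.
Qed.

Lemma mass_eq1_ae A i (j : 'I_(pd_r D i)) : measurable A ->
  mass A (pd_g j) = 1 <-> {ae m, forall x, 0 < pd_g j x -> A x}.
Proof.
move=> mA; split=> [g1|gA].
  by apply: mass_setT_ae => //; [exact: (pd_g_ge0 HD)|rewrite g1 (mass_pd_g HD)].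
apply/eqP; rewrite eq_le mass_le1//= -[leLHS](mass_pd_g HD j).
apply: ae_mass_subset => //; first exact: (pd_g_ge0 HD).
by apply: filterS gA => x Ax /Ax.
Qed.

Lemma mean_density_subP A i : measurable A ->
  ae_subset m (pos_support (mean_density i)) A <->
  forall j : 'I_(pd_r D i), mass A (pd_g j) = 1.
Proof.
move=> mA; rewrite ae_subsetP//; last exact: measurable_pos_support.
split=> [iA j|gA].
  apply/(mass_eq1_ae _ mA); apply: filterS2 iA (ae_pos_mean_density HD i).
  by move=> x iA [_ gi] gj; apply/iA/gi; exists j.
have : {ae m, forall x, forall j : 'I_(pd_r D i), 0 < pd_g j x -> A x}.
  by apply: filter_forall => j; apply/(mass_eq1_ae _ mA).
apply: filterS2 (ae_pos_mean_density HD i) => x [gi _] gj /gi[j].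
exact: gj.
Qed.

Lemma ae_mean_density_disjoint (i k : 'I_(pd_s D)) : i != k ->
  {ae m, forall x, ~ (0 < mean_density i x /\ 0 < mean_density k x)}.
Proof.
move=> ik.
have : {ae m, forall x, forall j : 'I_(pd_r D i), forall l : 'I_(pd_r D k),
    ~ (0 < pd_g j x /\ 0 < pd_g l x)}.
  apply: filter_forall => j; apply: filter_forall => l.
  by apply: (pd_g_disjoint HD); case=> /val_inj /eqP; rewrite (negbTE ik).
apply: filterS3 (ae_pos_mean_density HD i) (ae_pos_mean_density HD k).
by move=> x [gi _] [gk _] disj [/gi[j gj] /gk[l gl]]; apply: (disj j l).
Qed.

(** The support of the mean carries mass 1 of each density of its cycle, which a null set cannot
    do. *)
Lemma mean_density_neq0 (k : 'I_(pd_s D)) :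
  m (pos_support (mean_density k)) <> 0%E.
Proof.
have mk : measurable (pos_support (mean_density k)).
  by exact: measurable_pos_support.
pose j := Ordinal (pd_r_gt0 HD k).
have /(mean_density_subP k mk)/(_ j) k1 :
    ae_subset m (pos_support (mean_density k)) (pos_support (mean_density k)).
  by apply/ae_subsetP => //; exact: nearW.
move/(measure_eq0_ae mk) => k0.
have : mass (pos_support (mean_density k)) (pd_g j) = 0.
  by apply: mass_eq0 => //; apply: filterS k0.
by rewrite k1 => /eqP; rewrite oner_eq0.
Qed.

End Supports.

(** * Comparison of the cycles of [LS] with those of a single map *)

Section Comparison.
Context d (X : measurableType d) (R : realType) (m : probability X R).
Variables (LS : L1 m -> L1 m) (Dhat : periodic_data m).
Hypothesis HDhat : has_periodic_data LS Dhat.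
Variable T : {mfun X >-> X}.
Hypothesis Tns : nonsingular m T.
Hypothesis Tsub : forall i (j : 'I_(pd_r Dhat i)),
  ae_subset m (pos_support (pd_g j)) (T @^-1` pos_support (pd_g (ordS j))).
Variable D : periodic_data m.
Hypothesis HD : has_periodic_data (PF T) D.
Implicit Types (i : 'I_(pd_s Dhat)) (k : 'I_(pd_s D)).

Let Ahat i : set X := pos_support (mean_density i).
Let A k : set X := pos_support (mean_density k).

Let mAhat i : measurable (Ahat i). Proof. exact: measurable_pos_support. Qed.
Let mA k : measurable (A k). Proof. exact: measurable_pos_support. Qed.

Lemma mean_support_invariant i : ae_subset m (Ahat i) (T @^-1` Ahat i).
Proof.
apply/ae_subsetP => //; first exact: measurable_preimage.
have Tsub' : {ae m, forall x, forall j : 'I_(pd_r Dhat i),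
    0 < pd_g j x -> 0 < pd_g (ordS j) (T x)}.
  apply: filter_forall => j; have /ae_subsetP := Tsub j; apply.
    exact: measurable_pos_support.
  by apply: measurable_preimage; exact: measurable_pos_support.
have gi := ae_pos_mean_density HDhat i.
apply: filterS3 Tsub' gi (ae_preimage Tns gi) => x Tx [gx _] [_ gTx].
by move=> /gx[j /Tx gj]; apply: gTx; exists (ordS j).
Qed.

(** A constant chain has period 1, so a positive mass equals 1. Masses do not decrease along the
    chain, so positivity spreads from [l] to the whole cycle. *)
Lemma mass_mean_support i k (l l' : 'I_(pd_r D k)) :
  0 < mass (Ahat i) (pd_g l) -> mass (Ahat i) (pd_g l') = 1.
Proof.
have subC (n : nat) := mean_support_invariant i.
have all1 (l0 : 'I_(pd_r D k)) :
    0 < mass (Ahat i) (pd_g l0) -> mass (Ahat i) (pd_g l0) = 1.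
  exact: (mass_periodic_chain Tns HD (fun=> mAhat i) subC (ltn0Sn 0)
    (fun _ _ => erefl)).
move=> l0; have [n <-] := iter_ordS_trans l l'; apply: all1.
apply: lt_le_trans l0 _.
exact: (mass_chain_le Tns HD l (fun=> mAhat i) subC).
Qed.

Lemma mean_support_dichotomy i k :
  ae_subset m (A k) (Ahat i) \/ m (Ahat i `&` A k) = 0%E.
Proof.
have [[l l0]|nl] := pselect (exists l : 'I_(pd_r D k), 0 < mass (Ahat i) (pd_g l)).
  by left; apply/(mean_density_subP HD) => //
    => l'; exact: mass_mean_support l0.
right; apply/measure_eq0_ae; first exact: measurableI.
have : {ae m, forall x, forall l : 'I_(pd_r D k), Ahat i x -> ~ 0 < pd_g l x}.
  apply: filter_forall => l; apply: (mass_eq0_not_pos HD) => //.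
  apply/eqP; rewrite eq_le mass_ge0//; last exact: (pd_g_ge0 HD).
  by rewrite andbT leNgt; apply/negP => l0; apply: nl; exists l.
apply: filterS2 (ae_pos_mean_density HD k) => x [gk _] nA [Ax /gk[l gl]].
exact: (nA l).
Qed.

(** Otherwise every [pd_g l] has mass zero on [Ahat i]. For the constant sequence [Ahat i] and a
    density of the cycle [i] of [Dhat], which keeps mass 1 by invariance, [asymptotic_mass] would
    then say that 1 tends to 0. *)
Lemma mean_support_meets i : exists k, m (Ahat i `&` A k) <> 0%E.
Proof.
apply: contrapT => nk.
have g0 k (l : 'I_(pd_r D k)) : mass (Ahat i) (pd_g l) = 0.
  have /measure_eq0_ae : m (Ahat i `&` A k) = 0%E.
    by apply: contrapT => k0; apply: nk; exists k.
  move=> /(_ (measurableI _ _ (mAhat i) (mA k))) disj; apply: mass_eq0 => //.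
  apply: filterS3 (ae_pos_mean_density HD k) (pd_g_ge0 HD l) disj.
  move=> x [_ gk] gl dis Ax; apply/eqP; rewrite eq_le gl andbT leNgt.
  by apply/negP => l0; apply: dis; split=> //; apply: gk; exists l.
pose j := Ordinal (pd_r_gt0 HDhat i).
have := asymptotic_mass Tns HD (pd_g j) (fun=> mAhat i).
rewrite [X in X @ \oo](_ : _ = cst 1).
  move/(cvg_unique (@norm_hausdorff _ _) (cvg_cst _))/eqP.
  by rewrite oner_eq0.
apply/funext => n; rewrite big1 ?subr0; last first.
  by move=> k _; rewrite big1// => l _; rewrite g0 mulr0.
apply/(mass_eq1_ae HDhat); first exact: measurable_preimage_iter.
have := ae_subset_chain Tns (fun=> mAhat i) (fun=> mean_support_invariant i) n.
apply: filterS2 (ae_pos_mean_density HDhat i) => x [_ gi] Cx gj.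
by apply: Cx; apply: gi; exists j.
Qed.

Lemma mean_support_contains i : exists k, ae_subset m (A k) (Ahat i).
Proof.
have [k k0] := mean_support_meets i; exists k.
by have [//|] := mean_support_dichotomy i k.
Qed.

Lemma mean_support_meets_bigcup i : (0 < m (Ahat i `&` \bigcup_k A k))%E.
Proof.
have [k k0] := mean_support_meets i.
have mU : measurable (\bigcup_k A k).
  by apply: fin_bigcup_measurable => //; exact: finite_finset.
apply: (@lt_le_trans _ _ (m (Ahat i `&` A k))).
  by rewrite lt0e measure_ge0 andbT; apply/eqP.
apply: le_measure; rewrite ?inE; [exact: measurableI..|].
by apply: setIS => x Ax; exists k.
Qed.

(** Choose for each [i] some [A k] inside [Ahat i]. The choice is injective because the sets
    [Ahat i] are almost disjoint and no [A k] is null. *)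
Lemma leq_pd_s : (pd_s Dhat <= pd_s D)%N.
Proof.
pose F i := sval (cid (mean_support_contains i)).
have FP i : ae_subset m (A (F i)) (Ahat i) by rewrite /F; case: cid.
suff : injective F by move/leq_card; rewrite !card_ord.
move=> i i' FE; apply/eqP; apply: contrapT => /negP ii'.
have Fi := (ae_subsetP m (mA _) (mAhat _)).1 (FP i).
have := FP i'; rewrite -FE => /(ae_subsetP m (mA _) (mAhat _)) Fi'.
apply: (mean_density_neq0 HD (k := F i)); apply/measure_eq0_ae; first exact: mA.
apply: filterS3 Fi Fi' (ae_mean_density_disjoint HDhat ii') => x Fi Fi' disj Ax.
by apply: disj; split; [exact: Fi|exact: Fi'].
Qed.

Lemma dvdn_pd_r i k : ae_subset m (A k) (Ahat i) -> (pd_r Dhat i %| pd_r D k)%N.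
Proof.
move=> /(mean_density_subP HD k (mAhat i)) kA.
pose l := Ordinal (pd_r_gt0 HD k).
(* [pd_g l] has mass 1 on [Ahat i], which is up to a null set a finite union of supports, so one of
   these is charged. *)
have [j j0] : exists j : 'I_(pd_r Dhat i), 0 < mass (pos_support (pd_g j)) (pd_g l).
  apply: contrapT => nj.
  have : {ae m, forall x, forall j : 'I_(pd_r Dhat i),
      pos_support (pd_g j) x -> ~ 0 < pd_g l x}.
    apply: filter_forall => j; have mj := measurable_pos_support (pd_g j).
    apply: (mass_eq0_not_pos HD) => //.
    apply/eqP; rewrite eq_le mass_ge0//; last exact: (pd_g_ge0 HD).
    by rewrite andbT leNgt; apply/negP => gj; apply: nj; exists j.
  move=> nj'; have : mass (Ahat i) (pd_g l) = 0.
    apply: mass_eq0 => //.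
    apply: filterS3 nj' (pd_g_ge0 HD l) (ae_pos_mean_density HDhat i).
    move=> x nlx gl [gi _] /gi[j gj]; apply/eqP; rewrite eq_le gl andbT leNgt.
    by apply/negP; exact: nlx gj.
  by rewrite kA => /eqP; rewrite oner_eq0.
pose C n := pos_support (pd_g (iter n (@ordS _) j)).
have mC n : measurable (C n) by exact: measurable_pos_support.
have subC n : ae_subset m (C n) (T @^-1` C n.+1) by exact: Tsub.
have C0 : mass (C 0%N) (pd_g l) = 1.
  apply: (mass_periodic_chain Tns HD mC subC (pd_r_gt0 HDhat i)) => // n ?.
  by rewrite /C iter_ordS_mod.
(* After [pd_r D k] steps the density is again [pd_g l], while the set has moved along the cycle of
   [Dhat]. *)
have Cr : mass (C (pd_r D k)) (pd_g l) = 1.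
  apply/eqP; rewrite eq_le (mass_le1 HD)//= -[leLHS]C0.
  have := mass_chain_le Tns HD l mC subC (pd_r D k).
  by rewrite iter_ordS_mod.
(* Distinct supports are almost disjoint and cannot both carry the full mass of [pd_g l]. *)
have jr : iter (pd_r D k) (@ordS _) j = j.
  apply/eqP; apply: contrapT => /negP jr.
  have disj : {ae m, forall x, ~ (C (pd_r D k) x /\ C 0%N x)}.
    by apply: (pd_g_disjoint HDhat) => -[] /val_inj /eqP; rewrite (negbTE jr).
  move/(mass_eq1_ae HD l (mC _)) : C0 => C0.
  move/(mass_eq1_ae HD l (mC _)) : Cr => Cr.
  have : mass setT (pd_g l) = 0.
    apply: mass_eq0 => //.
    have nC : {ae m, forall x, ~ 0 < pd_g l x}.
      apply: filterS3 C0 Cr disj => x C0 Cr disj l0.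
      by apply: disj; split; [exact: Cr|exact: C0].
    apply: filterS2 nC (pd_g_ge0 HD l) => x nl gl _; apply/eqP.
    by rewrite eq_le gl andbT leNgt; apply/negP.
  by rewrite (mass_pd_g HD) => /eqP; rewrite oner_eq0.
have /eqP := congr1 val jr.
rewrite val_iter_ordS -[X in _ == X](modn_small (ltn_ord j)).
by rewrite -{2}[val j]addn0 eqn_modDl mod0n.
Qed.

End Comparison.

(** * Existence of the set [Y0], by testing the skew product operator *)

Lemma ae_fst d1 d2 (T1 : measurableType d1) (T2 : measurableType d2)
    (R : realType) (m1 : probability T1 R) (m2 : probability T2 R)
    (P : T1 -> Prop) :
  {ae m1, forall x, P x} -> {ae (m1 \x m2)%E, forall z, P z.1}.
Proof.
case=> N [mN N0 subN]; exists (N `*` setT); split.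
- exact: measurableX.
- transitivity (m1 N * m2 setT)%E; first exact: product_measure1E.
  by rewrite N0 mul0e.
- by move=> z nPz; split=> //; exact: subN.
Qed.

(** Coordinates are continuous, and open sets generate the Borel field. *)
Lemma measurable_eval (R : realType) (Y : completeMetricType R) (n : nat) :
  measurable_fun [set: borel (seqspace Y)]
    (fun w : borel (seqspace Y) => (w n : borel Y)).
Proof.
refine (@measurability _ _ (borel (seqspace Y)) (borel Y) setT _ (@open Y)
  erefl _).
move=> _ [U oU <-]; rewrite setTI; apply: sub_sigma_algebra.
exact: ((@continuousP (seqspace Y) Y (proj n)).1
  (@proj_continuous nat (fun=> Y) n) U oU).
Qed.

Section SkewSupport.
Context (R : realType) (d : measure_display) (X : measurableType d).
Variables (m : probability X R) (Y : completeMetricType R).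
Variables (eta : probability (borel Y) R).
Variables (P : probability (borel (seqspace Y)) R).
Hypothesis hP : is_product_probability eta P.
Variable T : Y -> {mfun X >-> X}.
Hypothesis hT : measurable_fun [set: X * borel Y]
  (fun p : X * borel Y => T p.2 p.1).
Variables (LS : L1 m -> L1 m).
Hypothesis hLS : is_skew_PF P T LS.

Lemma product_probability_eval0 (A : set (borel Y)) : measurable A ->
  P [set w : seqspace Y | A (w 0%N)] = eta A.
Proof.
move=> mA; have := @hP 1 (fun=> A) (fun=> mA); rewrite big_ord1 => <-.
congr (P _); apply/seteqP; split=> w /=; last exact.
by move=> Aw i; rewrite ltnS leqn0 => /eqP ->.
Qed.

Variables f g : L1 m.
Hypothesis f_ge0 : {ae m, forall x, 0 <= f x}.
Hypothesis g_ge0 : {ae m, forall x, 0 <= g x}.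
Hypothesis LSfg : {ae m, forall x, LS f x = g x}.

Let G : set X := pos_support g.
Let mG : measurable G. Proof. exact: measurable_pos_support. Qed.

(** This measures the part of [f] that [T p.2] sends outside [G]. The absolute value makes it
    nonnegative everywhere, as Tonelli requires. *)
Let k (p : X * borel Y) : R := `|f p.1| * \1_(~` G) (T p.2 p.1).

Let k_ge0 p : 0 <= k p.
Proof. by rewrite mulr_ge0. Qed.

Let measurable_k : measurable_fun setT (EFin \o k).
Proof.
apply/measurable_EFinP; apply: measurable_funM.
  by apply: measurableT_comp => //; exact: measurableT_comp.
apply: (measurableT_comp (f := \1_(~` G) : X -> R)) => //.
by apply: measurable_indic; exact: measurableC.
Qed.

Let phi (y : borel Y) : \bar R := (\int[m]_x (k (x, y))%:E)%E.

Let measurable_phi : measurable_fun setT phi.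
Proof. exact: (measurable_fun_fubini_tonelli_G (EFin \o k)). Qed.

Let proj0 (z : X * borel (seqspace Y)) : X * borel Y := (z.1, z.2 0%N).

Let measurable_proj0 : measurable_fun setT proj0.
Proof.
apply: measurable_fun_pair => //.
by apply: (measurableT_comp (measurable_eval 0)).
Qed.

Let integral_k : (\int[m \x P]_z (k (proj0 z))%:E = 0)%E.
Proof.
(* With this test function the operator side is the integral of [g] over the complement of its own
   support, hence zero. *)
pose h (z : X * borel (seqspace Y)) : R := \1_(~` G) z.1.
have mh : measurable_fun setT h.
  apply: (measurableT_comp (f := \1_(~` G) : X -> R)) => //.
  by apply: measurable_indic; exact: measurableC.
have hL : h \in Lfun (m \x P)%E +oo%E.
  rewrite inE; apply/andP; split; rewrite inE //= /finite_norm unlock.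
  case: ifP => // _; apply: (@le_lt_trans _ _ 1%E); last exact: ltry.
  apply/ess_sup_inf.ess_supP; apply: nearW => z /=.
  by rewrite lee_fin /h indicE; case: (_ \in _); rewrite ?normr1// normr0.
have mkp : measurable_fun setT (fun z : X * borel (seqspace Y) =>
    (k (proj0 z))%:E).
  exact: (measurableT_comp measurable_k measurable_proj0).
have mfh : measurable_fun setT (fun z : X * borel (seqspace Y) =>
    (f z.1 * h (skew_product T z))%:E).
  apply/measurable_EFinP; apply: measurable_funM; first exact: measurableT_comp.
  apply: (measurableT_comp (f := \1_(~` G) : X -> R)).
    by apply: measurable_indic; exact: measurableC.
  exact: (measurableT_comp hT measurable_proj0).
transitivity (\int[m \x P]_z (f z.1 * h (skew_product T z))%:E)%E.
  apply: ae_eq_integral => //; rewrite /ae_eq.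
  apply: filterS (ae_fst P f_ge0) => z fz _.
  by rewrite /k /= ger0_norm.
rewrite -hLS//.
transitivity (\int[m \x P]_z (cst 0 z))%E; last exact: integral0.
apply: ae_eq_integral => //.
  apply/measurable_EFinP; apply: measurable_funM => //.
  exact: measurableT_comp.
rewrite /ae_eq; apply: filterS2 (ae_fst P g_ge0) (ae_fst P LSfg) => z gz LSz _.
rewrite /h /= LSz indicE; case: (boolP (_ \in _)); last by rewrite mul0r.
move/set_mem => nG; rewrite mul1r; congr EFin; apply/eqP.
by rewrite eq_le gz andbT leNgt; apply/negP.
Qed.

Lemma ae_transports_support : exists N : set (borel Y),
  [/\ measurable N, eta N = 0%E &
     forall y, ~ N y -> ae_subset m (pos_support f) (T y @^-1` pos_support g)].
Proof.
(* By Tonelli [phi] of coordinate 0 vanishes [P]-almost surely, and coordinate 0 has law [eta];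
   hence [N] is null. *)
pose N := [set y | phi y != 0%E].
have mN : measurable N.
  by rewrite -[N]setTI; apply: emeasurable_neq.
exists N; split=> // [|y].
  rewrite -product_probability_eval0//.
  have mphi0 : measurable_fun setT (fun w : borel (seqspace Y) => phi (w 0%N)).
    exact: (measurableT_comp measurable_phi (measurable_eval 0)).
  have phi_ge0 y : (0 <= phi y)%E.
    by apply: integral_ge0 => x _; rewrite lee_fin.
  have : (\int[P]_w `|phi (w 0%N)| = 0)%E.
    rewrite -integral_k.
    rewrite (fubini_tonelli2 (fun z => (k (proj0 z))%:E)) => [|//|z].
    - by apply: eq_integral => w _; rewrite gee0_abs.
    - exact: (measurableT_comp measurable_k measurable_proj0).
    - by rewrite lee_fin.
  move/(ae_eq_integral_abs _ measurableT mphi0) => /negligibleP.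
  rewrite (_ : ~` _ = [set w | N (w 0%N)]).
    apply; rewrite -[X in measurable X]setTI.
    exact: (measurable_eval 0).
  apply/seteqP; split=> w /=; first by rewrite not_implyE => -[_ /eqP].
  by move=> /eqP Nw; apply/not_implyP.
move=> /negP; rewrite negbK => /eqP phiy.
apply/ae_subsetP; first exact: measurable_pos_support.
  by apply: measurable_preimage; exact: measurable_pos_support.
have mky : measurable_fun setT (fun x => (k (x, y))%:E).
  exact: (measurableT_comp measurable_k).
have : (\int[m]_x `|(k (x, y))%:E| = 0)%E.
  by rewrite -phiy; apply: eq_integral => x _; rewrite gee0_abs// lee_fin.
move/(ae_eq_integral_abs _ measurableT mky); apply: filterS => x /(_ I)[] kxy fx.
apply: contrapT => nG; move: kxy; rewrite /k /= indicE mem_set// mulr1.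
by move/eqP; rewrite normr_eq0 gt_eqF.
Qed.

End SkewSupport.

Theorem theorem1 (R : realType) (d : measure_display) (X : measurableType d)
    (m : probability X R)
    (Y : completeMetricType R) (hY : separable Y)
    (eta : probability (borel Y) R)
    (P : probability (borel (seqspace Y)) R)
    (hP : is_product_probability eta P)
    (T : Y -> {mfun X >-> X})
    (hTns : forall y, nonsingular m (T y))
    (hT : measurable_fun [set: X * borel Y] (fun p : X * borel Y => T p.2 p.1))
    (LS : L1 m -> L1 m) (hLS : is_skew_PF P T LS)
    (Dhat : periodic_data m) (hDhat : has_periodic_data LS Dhat) :
  (exists Y0 : set (borel Y), transports_supports eta T Dhat Y0) /\
  forall Y0 : set (borel Y), transports_supports eta T Dhat Y0 ->
  let Y1 : set Y := [set y | asymptotically_periodic (PF (m := m) (T y))] in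
  forall D : Y -> periodic_data m,
  (forall y, Y1 y -> has_periodic_data (PF (T y)) (D y)) ->
  forall (i : 'I_(pd_s Dhat)) (y : Y), (Y0 `&` Y1) y ->
  let Ahat : set X := pos_support (mean_density i) in
  let A (k : 'I_(pd_s (D y))) : set X := pos_support (mean_density k) in
  ((0 < m (Ahat `&` \bigcup_k A k))%E /\
   (forall k, ae_subset m (A k) Ahat \/ m (Ahat `&` A k) = 0%E) /\
   (pd_s Dhat <= pd_s (D y))%N) /\
  (forall k0, ae_subset m (A k0) Ahat -> (pd_r Dhat i %| pd_r (D y) k0)%N).
Proof.
split; last first.
  move=> Y0 [_ _ TY0] Y1 D HD i y [Y0y Y1y].
  have Tsub := TY0 y Y0y; have HDy := HD y Y1y.
  split; [split; [|split]|].
  - exact: (mean_support_meets_bigcup hDhat (hTns y) Tsub HDy).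
  - exact: (mean_support_dichotomy hDhat (hTns y) Tsub HDy).
  - exact: (leq_pd_s hDhat (hTns y) Tsub HDy).
  - exact: (dvdn_pd_r hDhat (hTns y) Tsub HDy).
have Nex i (j : 'I_(pd_r Dhat i)) : exists N : set (borel Y),
    [/\ measurable N, eta N = 0%E & forall y, ~ N y ->
      ae_subset m (pos_support (pd_g j))
                  (T y @^-1` pos_support (pd_g (ordS j)))].
  apply: (ae_transports_support hP hT hLS);
    [exact: (pd_g_ge0 hDhat)..|].
  by case: hDhat => _ _ _ + _; apply.
pose N i (j : 'I_(pd_r Dhat i)) := sval (cid (Nex i j)).
have NP i (j : 'I_(pd_r Dhat i)) := svalP (cid (Nex i j)).
(* One exceptional null set per density; the union is finite, and its complement serves as [Y0]. *)
pose U : set (borel Y) := \bigcup_i \bigcup_j N i j.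
have mU : measurable U.
  apply: fin_bigcup_measurable; first exact: finite_finset.
  move=> i _; apply: fin_bigcup_measurable; first exact: finite_finset.
  by move=> j _; have [] := NP i j.
exists (~` U); split; first exact: measurableC.
  rewrite probability_setC// (_ : eta U = 0%E) ?sube0//.
  apply/measure_eq0_ae => //.
  have : {ae eta, forall y, forall i (j : 'I_(pd_r Dhat i)), ~ N i j y}.
    apply: filter_forall => i; apply: filter_forall => j.
    by have [mN N0 _] := NP i j; apply/measure_eq0_ae.
  by apply: filterS => y nN [i _ [j _ Ny]]; exact: (nN i j).
move=> y nUy i j; have [_ _] := NP i j; apply=> Ny.
by apply: nUy; exists i => //; exists j.
Qed.
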